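(* For all integers $n \ge d \ge 2$, the quantities $\beta_2(q,n,d)$ and $w_2(q,n,d)$ are polynomials in $q$; that is, there exist polynomials $p_1,p_2\in\mathbb{Q}[x]$ (depending only on $n,d$) such that $\beta_2(q,n,d)=p_1(q)$ and $w_2(q,n,d)=p_2(q)$ for all prime powers $q$.
   Context: Let $q$ be a prime power. The Hamming weight of $v \in \mathbb{F}_q^n$ is the number of its nonzero coordinates. For integers $n,d\ge 1$, the higher-weight Dowling lattice $\mathcal{H}(q,n,d)$ is the set, ordered by inclusion, of all $\mathbb{F}_q$-linear subspaces of $\mathbb{F}_q^n$ that have a basis made of vectors of Hamming weight at most $d$, together with the zero space. It is a finite geometric lattice whose rank function is the $\mathbb{F}_q$-dimension. With $\mu$ the Möbius function of $\mathcal{H}(q,n,d)$, the $i$-th Whitney number (of the first kind) is $w_i(q,n,d)=\sum_{U \in \mathcal{H}(q,n,d),\ \dim U=i} \mu(\{0\},U)$. $\beta_k(q,n,d)$ denotes the number of $k$-dimensional $\mathbb{F}_q$-subspaces $C\le\mathbb{F}_q^n$ with minimum Hamming distance at most $d$, i.e. containing a nonzero vector of Hamming weight at most $d$. *)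

(* Defs.v *)
From HB Require Import structures.
From mathcomp Require Import all_boot all_order all_algebra all_field.

Set Implicit Arguments.
Unset Strict Implicit.
Unset Printing Implicit Defensive.

Import Order.TTheory GRing.Theory Num.Theory.
Local Open Scope ring_scope.

Section VspaceFinite.
Import VectorInternalTheory.
Variables (F : finFieldType) (n : nat).

HB.instance Definition _ := [Countable of {vspace 'rV[F]_n} by <:].
HB.instance Definition _ := [Finite of {vspace 'rV[F]_n} by <:].

End VspaceFinite.

Section Mobius.
Context {disp : Order.disp_t} {T : finPOrderType disp}.

(* [k] is fuel for the recursion on [y]: [#|T|] bounds the length of any
   chain, and [mobius_lt] and [sum_mobius] below show that it never runs
   out.  When [x] is not below [y] the sum is empty and the value is 0. *)
Fixpoint mobius_rec (k : nat) (x y : T) : int :=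
  if x == y then 1 else
  if k is k'.+1 then - \sum_(z | (x <= z < y)%O) mobius_rec k' x z else 0.

Definition mobius (x y : T) : int := mobius_rec #|T| x y.

Lemma mobius_rec_fuel k1 k2 (x y : T) :
    (#|[pred z : T | (z < y)%O]| <= k1)%N ->
    (#|[pred z : T | (z < y)%O]| <= k2)%N ->
  mobius_rec k1 x y = mobius_rec k2 x y.
Proof.
have sum0 (u v : T) (f : T -> int) : (#|[pred z : T | (z < v)%O]| <= 0)%N ->
    - (\sum_(z | (u <= z < v)%O) f z) = 0.
  rewrite leqn0 => /eqP/card0_eq h; rewrite big1 ?oppr0 // => z /andP[_ zv].
  by have := h z; rewrite inE zv.
have card_lt (z v : T) : (z < v)%O ->
    (#|[pred t : T | (t < z)%O]| < #|[pred t : T | (t < v)%O]|)%N.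
  move=> zv; apply/proper_card/properP; split.
    by apply/subsetP => t; rewrite !inE => /lt_trans; apply.
  by exists z; rewrite !inE ?zv ?ltxx.
elim: k1 k2 y => [|k1 IH] [|k2] y h1 h2 //=; case: eqP => // _.
- by rewrite sum0.
- by rewrite sum0.
congr (- _); apply: eq_bigr => z /andP[_ zy].
by apply: IH; rewrite -ltnS (leq_trans (card_lt z y zy)).
Qed.

Lemma mobiusxx (x : T) : mobius x x = 1.
Proof. by rewrite /mobius; case: #|T| => [|k] /=; rewrite eqxx. Qed.

Lemma mobius_lt (x y : T) :
  (x < y)%O -> mobius x y = - \sum_(z | (x <= z < y)%O) mobius x z.
Proof.
move=> xy; rewrite /mobius.
rewrite (@mobius_rec_fuel #|T| #|T|.+1) ?leqW ?max_card //=.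
by rewrite (lt_eqF xy).
Qed.

Lemma mobius_nle (x y : T) : ~~ (x <= y)%O -> mobius x y = 0.
Proof.
move=> xy; have nxy : x != y by apply: contraNneq xy => ->.
rewrite /mobius; case: #|T| => [|k] /=; rewrite (negPf nxy) //.
rewrite big1 ?oppr0 // => z /andP[xz /ltW zy].
by rewrite (le_trans xz zy) in xy.
Qed.

Lemma sum_mobius (x y : T) :
  \sum_(z | (x <= z <= y)%O) mobius x z = (x == y)%:R.
Proof.
have [->|nxy] := eqVneq x y.
  rewrite (bigD1 y) ?lexx //= mobiusxx big1 ?addr0 // => z.
  by rewrite -eq_le eq_sym andbN.
have [xy|xy] := boolP (x <= y)%O; last first.
  by rewrite big1 // => z /andP[xz zy]; rewrite (le_trans xz zy) in xy.
rewrite (bigD1 y) ?lexx ?xy //= mobius_lt ?lt_neqAle ?nxy //.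
rewrite [X in _ + X](eq_bigl (fun z => (x <= z < y)%O)) ?addNr // => z.
by rewrite lt_neqAle andbAC andbA.
Qed.

End Mobius.

Definition hamming_weight (F : finFieldType) (n : nat) (v : 'rV[F]_n) : nat :=
  #|[set i | v 0 i != 0]|.

(* The zero space satisfies this with the empty basis. *)
Definition has_light_basis (F : finFieldType) (n d : nat)
    (U : {vspace 'rV[F]_n}) : bool :=
  [exists X : (\dim U).-tuple 'rV[F]_n,
     basis_of U X && all (fun v => (hamming_weight v <= d)%N) X].

Lemma has_light_basis0 (F : finFieldType) (n d : nat) :
  has_light_basis d (0%VS : {vspace 'rV[F]_n}).
Proof.
apply/existsP; exists (vbasis 0%VS); rewrite vbasisP /=.
by case: (vbasis _) => s /=; rewrite dimv0 => /eqP/size0nil ->.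
Qed.

Record dowling (F : finFieldType) (n d : nat) : Type := Dowling {
  dowling_space :> {vspace 'rV[F]_n};
  _ : has_light_basis d dowling_space }.

Fact dowling_display : Order.disp_t. Proof. exact: Order.Disp tt tt. Qed.

Section DowlingPOrder.
Variables (F : finFieldType) (n d : nat).
Local Notation H := (dowling F n d).

HB.instance Definition _ := [isSub for @dowling_space F n d].
HB.instance Definition _ := [Finite of H by <:].

Definition dowling_le (U V : H) : bool := (U <= V)%VS.

Lemma dowling_le_refl : reflexive dowling_le.
Proof. by move=> U; apply: subvv. Qed.

Lemma dowling_le_anti : antisymmetric dowling_le.
Proof. by move=> U V UV; apply/val_inj/eqP; rewrite eqEsubv. Qed.

Lemma dowling_le_trans : transitive dowling_le.
Proof. by move=> V U W; apply: subv_trans. Qed.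

HB.instance Definition _ := Order.Le_isPOrder.Build dowling_display H
  dowling_le_refl dowling_le_anti dowling_le_trans.

Definition dowling0 : H := Dowling (has_light_basis0 F n d).

Lemma dowling0_le (U : H) : (dowling0 <= U)%O.
Proof. exact: sub0v. Qed.

HB.instance Definition _ :=
  Order.hasBottom.Build dowling_display H dowling0_le.

End DowlingPOrder.

Definition whitney (F : finFieldType) (i n d : nat) : int :=
  \sum_(U : dowling F n d | \dim U == i) mobius \bot%O U.

Definition beta (F : finFieldType) (k n d : nat) : nat :=
  #|[set C : {vspace 'rV[F]_n} | (\dim C == k) &&
      [exists v in C, (v != 0) && (hamming_weight v <= d)%N]]|.

(* Main.v *)
Require Import Defs.
From mathcomp Require Import all_boot all_order all_algebra all_field.
From mathcomp Require Import ring.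
Import Order.TTheory GRing.Theory Num.Theory.
Local Open Scope ring_scope.

(** Both numbers come from counting planes, i.e. subspaces of dimension 2,
    in [F ^ n], where [q = #|F|].

    For [beta], count instead the planes that avoid the weights [1 .. d]: they
    are the complement of the planes in question, and for [d = 0] they are all
    planes.  An ordered basis [(v, u)] of a plane is a 2 x n matrix, and each of
    its columns is either zero or lies on one of the [q + 1] lines of [F ^ 2].
    Up to scaling, the nonzero vectors of the plane correspond to these lines:
    the vector attached to a line vanishes exactly at the columns that are zero
    or on the line.  So avoiding low weights only depends on how the positions
    are coloured by lines ([spread_slopes]), and not even on which line is which
    colour.  A colouring with [m] nonzero positions arises from [(q - 1) ^ m]
    matrices ([card_slopes]), and choosing which [k] lines are used gives
    [(q - 1) ^ m * 'C(q + 1, k)] times a number of colourings independent of [q]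
    ([sum_by_colours]).  Every plane has [(q ^ 2 - 1) * (q ^ 2 - q)] ordered
    bases ([card_avoiding_planes]).  The colourings that matter have [k >= 2],
    hence [m >= 2], and this makes each term of the sum divisible, as a
    polynomial in [q], by the number of bases ([pattern_quotientE]).

    For the Whitney number, a plane [U] of the lattice containing [a] light
    lines (lines spanned by a nonzero vector of weight at most [d]) has Möbius value
    [a - 1] ([mobius_plane]).  Planes with [a = 1] contribute nothing and planes
    with [a = 0] are not counted by [beta], so the sum of [a] over all planes
    is [whitney + beta] ([whitney_light_lines]).  That sum counts the incidences
    between light lines and planes, which is elementary ([sum_light_lines]). *)

Set Implicit Arguments.
Unset Strict Implicit.
Unset Printing Implicit Defensive.

(** * Functions of a finite field that are polynomials in its cardinal *)

Definition poly_in_card (f : finFieldType -> rat) : Prop :=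
  exists p : {poly rat}, forall F : finFieldType, f F = p.[#|F|%:R].

Lemma eq_poly_in_card (f g : finFieldType -> rat) :
  (forall F, f F = g F) -> poly_in_card g -> poly_in_card f.
Proof. by move=> fg [p gp]; exists p => F; rewrite fg. Qed.

Lemma poly_in_card_horner (p : {poly rat}) :
  poly_in_card (fun F => p.[#|F|%:R]).
Proof. by exists p. Qed.

Lemma poly_in_cardB f g : poly_in_card f -> poly_in_card g ->
  poly_in_card (fun F => f F - g F).
Proof. by move=> [p fp] [r gr]; exists (p - r) => F; rewrite !hornerE fp gr. Qed.

Lemma poly_in_cardM f g : poly_in_card f -> poly_in_card g ->
  poly_in_card (fun F => f F * g F).
Proof. by move=> [p fp] [r gr]; exists (p * r) => F; rewrite !hornerE fp gr. Qed.

Lemma poly_in_card_sum (I : Type) (s : seq I) (P : pred I)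
    (f : I -> finFieldType -> rat) :
  (forall i, P i -> poly_in_card (f i)) ->
  poly_in_card (fun F => \sum_(i <- s | P i) f i F).
Proof.
move=> fP; elim: s => [|i s [p IH]].
  by exists 0 => F; rewrite big_nil horner0.
have [Pi|nPi] := boolP (P i); last first.
  by exists p => F; rewrite big_cons (negPf nPi).
have [r fr] := fP i Pi.
by exists (r + p) => F; rewrite big_cons Pi hornerD IH fr.
Qed.

(** The falling factorial has truncated differences and the product has true
    ones; when [m < k], so that they differ, both contain a zero factor. *)
Lemma natr_ffact (m k : nat) :
  (m ^_ k)%:R = \prod_(i < k) (m%:R - i%:R) :> rat.
Proof.
elim: k => [|k IH]; first by rewrite big_ord0.
rewrite ffactnSr big_ord_recr -IH natrM /=.
have [km|mk] := leqP k m; first by rewrite natrB.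
by rewrite ffact_small // !mul0r.
Qed.

(** * Colour patterns of words with blanks *)

Section Patterns.
Variable n : nat.

Definition colours (P : finType) (g : {ffun 'I_n -> option P}) : {set P} :=
  [set p | [exists i, g i == Some p]].

Definition painted (P : finType) (g : {ffun 'I_n -> option P}) : {set 'I_n} :=
  [set i | g i != None].

Definition off_colour (P : finType) (g : {ffun 'I_n -> option P}) (p : P) :
  {set 'I_n} := [set i | (g i != None) && (g i != Some p)].

(** When [P] is the set of lines of [F ^ 2], this says that [g] comes from a
    basis of a plane all of whose nonzero vectors have weight above [d].  It is
    phrased with the colours that occur in [g] only, so that it is invariant
    under every injective renaming of colours, even into a larger palette. *)
Definition spread d (P : finType) (g : {ffun 'I_n -> option P}) : bool :=
  (1 < #|colours g|)%N && [forall p in colours g, (d < #|off_colour g p|)%N].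

Definition recolour (P P' : finType) (phi : P -> P')
    (g : {ffun 'I_n -> option P}) : {ffun 'I_n -> option P'} :=
  [ffun i => omap phi (g i)].

Lemma coloursP (P : finType) (g : {ffun 'I_n -> option P}) p :
  reflect (exists i, g i = Some p) (p \in colours g).
Proof.
rewrite inE; apply: (iffP existsP) => [[i /eqP]|[i gi]]; exists i => //.
exact/eqP.
Qed.

(** Distinct colours occupy distinct positions. *)
Lemma card_colours_le (P : finType) (g : {ffun 'I_n -> option P}) :
  (#|colours g| <= #|painted g|)%N.
Proof.
rewrite -(card_imset _ (@Some_inj _ : injective (@Some P))).
rewrite (leq_trans _ (leq_imset_card g _)) //.
apply/subset_leq_card/subsetP => _ /imsetP[p /coloursP[i gi] ->].
by rewrite -gi imset_f // inE gi.
Qed.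

Lemma colours_recolour (P P' : finType) (phi : P -> P') g :
  colours (recolour phi g) = phi @: colours g.
Proof.
apply/setP => p; apply/coloursP/imsetP => [[i]|[r /coloursP[i gi] ->]].
  rewrite ffunE; case gi: (g i) => [r|] //= [<-].
  by exists r => //; apply/coloursP; exists i.
by exists i; rewrite ffunE gi.
Qed.

Lemma painted_recolour (P P' : finType) (phi : P -> P') g :
  painted (recolour phi g) = painted g.
Proof. by apply/setP => i; rewrite !inE ffunE; case: (g i). Qed.

Lemma spread_recolour d (P P' : finType) (phi : P -> P') g :
  injective phi -> spread d (recolour phi g) = spread d g.
Proof.
move=> phiI; rewrite /spread colours_recolour card_imset //; congr andb.
have off p : off_colour (recolour phi g) (phi p) = off_colour g p.
  apply/setP => i; rewrite !inE ffunE; case: (g i) => [r|] //=.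
  by rewrite !(inj_eq (@Some_inj _)) (inj_eq phiI).
apply/'forall_implyP/'forall_implyP => [h p pg|h _ /imsetP[p pg ->]].
  by rewrite -off h // imset_f.
by rewrite off h.
Qed.

(** The palette [P] enters a sum of colour-blind weights only through its
    cardinal: sort the words [g] by the set [S] of colours that they use.  The
    words that use exactly the set [S] are transported to those that use the
    whole palette ['I_k], [k = #|S|], by any bijection between the two. *)
Lemma sum_by_colours (W : forall P : finType, {ffun 'I_n -> option P} -> nat)
    (P : finType) :
  (forall (Q Q' : finType) (phi : Q -> Q') g,
     injective phi -> W Q' (recolour phi g) = W Q g) ->
  (\sum_(g : {ffun 'I_n -> option P}) W P g =
   \sum_(k < n.+1) 'C(#|P|, k) *
     \sum_(h : {ffun 'I_n -> option 'I_k} | colours h == setT) W 'I_k h)%N.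
Proof.
move=> Winv.
have le_n (g : {ffun 'I_n -> option P}) : (#|colours g| < n.+1)%N.
  by rewrite ltnS (leq_trans (card_colours_le g)) //
    (leq_trans (max_card _)) ?card_ord.
rewrite (partition_big (fun g => inord #|colours g| : 'I_n.+1) predT) //=.
apply: eq_bigr => k _.
rewrite (partition_big (@colours P) (fun S => #|S| == k)) /=; last first.
  by move=> g /eqP <-; rewrite inordK.
rewrite -card_draws -sum_nat_const [RHS](eq_bigl (fun S : {set P} => #|S| == k));
  last by move=> S; rewrite inE.
apply: eq_bigr => S /eqP Sk.
rewrite (eq_bigl (fun g => colours g == S)); last first.
  move=> g; rewrite andbC; case: eqP => //= ->; apply/eqP/val_inj.
  by rewrite /= Sk inordK.
(* [phi] enumerates [S] and [psi] is its partial inverse. *)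
pose phi (i : 'I_k) : P := enum_val (cast_ord (esym Sk) i).
have phiI : injective phi by move=> i j /enum_val_inj/cast_ord_inj.
have phiS : phi @: setT = S.
  apply/setP => p; apply/imsetP/idP => [[i _ ->]|pS]; first exact: enum_valP.
  exists (cast_ord Sk (enum_rank_in pS p)) => //.
  by rewrite /phi cast_ordK enum_rankK_in.
pose psi (p : P) : option 'I_k := [pick i | phi i == p].
have psiK i : psi (phi i) = Some i.
  rewrite /psi; case: pickP => [j /eqP/phiI -> //|/(_ i)]; by rewrite eqxx.
pose unphi (g : {ffun 'I_n -> option P}) : {ffun 'I_n -> option 'I_k} :=
  [ffun i => obind psi (g i)].
rewrite (reindex_onto (recolour phi) unphi); last first.
  move=> g /eqP gS; apply/ffunP => i; rewrite !ffunE; case gi: (g i) => [p|] //=.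
  have : p \in phi @: setT by rewrite phiS -gS; apply/coloursP; exists i.
  by case/imsetP => j _ ->; rewrite psiK.
apply: eq_big => [h|h _]; last exact: Winv.
have -> : unphi (recolour phi h) == h.
  by apply/eqP/ffunP => i; rewrite !ffunE; case: (h i) => //= j; rewrite psiK.
by rewrite andbT colours_recolour -phiS (inj_eq (imset_inj phiI)).
Qed.

End Patterns.

(** * Planes of row vectors and patterns of slopes *)

Section Planes.
Variables (F : finFieldType) (n : nat).
Local Notation V := 'rV[F]_n.
Local Notation q := #|F|.

(** The lines of [F ^ 2] are indexed by [option F]: the slope of a nonzero
    vector, with [None] for the vertical line; the origin has no slope. *)
Definition slope (x y : F) : option (option F) :=
  if x == 0 then (if y == 0 then None else Some None) else Some (Some (y / x)).

Definition slopes (vu : V * V) : {ffun 'I_n -> option (option F)} :=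
  [ffun i => slope (vu.1 0 i) (vu.2 0 i)].

Lemma card_slope (o : option (option F)) :
  #|[pred c : F * F | slope c.1 c.2 == o]| = if o is None then 1%N else q.-1.
Proof.
case: o => [[s|]|].
- rewrite -(cardC1 (0 : F)) -(@card_imset _ _ (fun x : F => (x, s * x))).
    apply: eq_card => -[x y]; rewrite !inE /slope /=.
    apply/idP/imsetP => [|[z]].
      have [_|x0] := eqVneq x 0; first by case: ifP => _ /eqP.
      by move=> /eqP[<-]; exists x; rewrite ?inE // divfK.
    rewrite inE => z0 [-> ->]; by rewrite (negPf z0) mulfK.
  by move=> x y [].
- rewrite -(cardC1 (0 : F)) -(@card_imset _ _ (fun y : F => (0 : F, y))).
    apply: eq_card => -[x y]; rewrite !inE /slope /=.
    apply/idP/imsetP => [|[z]].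
      have [->|x0] := eqVneq x 0; last by move=> /eqP.
      have [_ /eqP|y0 _] := eqVneq y 0; by [|exists y; rewrite ?inE].
    by rewrite inE => z0 [-> ->]; rewrite eqxx (negPf z0).
  by move=> x y [].
- rewrite -(card1 (0 : F, 0 : F)); apply: eq_card => -[x y]; rewrite !inE /slope /=.
  by rewrite xpair_eqE; case: (x == 0); case: (y == 0).
Qed.

(** A nonzero vector of a given line of [F ^ 2] can be chosen in [q - 1] ways,
    independently at each position. *)
Lemma card_slopes (g : {ffun 'I_n -> option (option F)}) :
  #|[set vu | slopes vu == g]| = (q.-1 ^ #|painted g|)%N.
Proof.
pose cols (vu : V * V) : {ffun 'I_n -> F * F} := [ffun i => (vu.1 0 i, vu.2 0 i)].
have colsB : bijective cols.
  exists (fun f : {ffun _} => (\row_i (f i).1, \row_i (f i).2)) => [[v u]|f].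
    by congr pair; apply/rowP => i; rewrite mxE ffunE.
  by apply/ffunP => i; rewrite ffunE !mxE; case: (f i).
transitivity #|cols @^-1: family (fun i => [pred c | slope c.1 c.2 == g i])|.
  apply: eq_card => vu; rewrite !inE; apply/eqP/familyP => [<- i|h].
    by rewrite !inE !ffunE.
  by apply/ffunP => i; have := h i; rewrite !inE !ffunE => /eqP.
rewrite on_card_preimset; last exact: onW_bij.
rewrite card_family foldrE big_map big_enum /= -prod_nat_const.
rewrite [RHS]big_mkcond /=; apply: eq_bigr => i _.
by rewrite card_slope inE; case: (g i).
Qed.

(** The functional attached to the vertical line is the first coordinate, so
    the vector of the plane attached to it is the first basis vector. *)
Lemma hamming_weight_vertical vu :
  #|off_colour (slopes vu) None| = hamming_weight vu.1.
Proof.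
apply: eq_card => i; rewrite !inE !ffunE /slope.
by case: (vu.1 0 i == 0) => //; case: (vu.2 0 i == 0).
Qed.

(** The functional attached to the line of slope [s] is [y - s * x]. *)
Lemma hamming_weight_slope vu s :
  #|off_colour (slopes vu) (Some s)| = hamming_weight (vu.2 - s *: vu.1).
Proof.
apply: eq_card => i; rewrite !inE !ffunE !mxE /slope.
have [->|x0] := eqVneq (vu.1 0 i) 0.
  by rewrite mulr0 subr0; case: (vu.2 0 i == 0).
by rewrite !(inj_eq (@Some_inj _)) subr_eq0 /= -(can2_eq (mulfVK x0) (mulfK x0)).
Qed.

Lemma hamming_weight0 : hamming_weight (0 : V) = 0%N.
Proof. by apply: eq_card0 => i; rewrite !inE mxE eqxx. Qed.

Lemma hamming_weightZ a (v : V) :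
  a != 0 -> hamming_weight (a *: v) = hamming_weight v.
Proof.
by move=> a0; apply: eq_card => i; rewrite !inE mxE mulf_eq0 (negPf a0).
Qed.

Definition avoids_weight d (C : {vspace V}) : bool :=
  [forall v in C, (v != 0) ==> (d < hamming_weight v)%N].

(** Up to a nonzero scalar, a nonzero vector of the span of [v] and [u] is [v]
    or some [u - s *: v], and scaling preserves the weight.  The
    right-hand side also yields independence, because a vector whose weight
    exceeds [d] is nonzero. *)
Lemma avoids_weight_span d (vu : V * V) :
  free [:: vu.2; vu.1] && avoids_weight d <<[:: vu.2; vu.1]>> =
  (d < hamming_weight vu.1)%N &&
  [forall s, (d < hamming_weight (vu.2 - s *: vu.1)%R)%N].
Proof.
case: vu => v u /=; rewrite free_cons span_seq1 seq1_free.
have memP w : reflect (exists a b, w = a *: u + b *: v) (w \in <<[:: u; v]>>%VS).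
  rewrite span_cons span_seq1; apply: (iffP memv_addP) => [|[a [b ->]]].
    by move=> [_ /vlineP[a ->] [_ /vlineP[b ->] ->]]; exists a, b.
  by exists (a *: u); rewrite ?memvZ ?memv_line //;
     exists (b *: v); rewrite ?memvZ ?memv_line.
apply/andP/andP => [[/andP[uv v0] /forall_inP h]|[dv /forallP du]].
  split.
    apply: (implyP (h v _)) => //.
    by apply/memP; exists 0, 1; rewrite scale0r add0r scale1r.
  apply/forallP => s; apply: (implyP (h _ _)).
    by apply/memP; exists 1, (- s); rewrite scale1r scaleNr.
  by rewrite subr_eq0; apply: contraNneq uv => ->; rewrite memvZ ?memv_line.
have pos (w : V) : (d < hamming_weight w)%N -> w != 0.
  by apply: contraTneq => ->; rewrite hamming_weight0.
split.
  rewrite pos // andbT; apply/vlineP => -[s us].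
  by have := pos _ (du s); rewrite us subrr eqxx.
apply/forall_inP => w /memP[a [b ->]]; apply/implyP.
have [->|a0] := eqVneq a 0.
  rewrite scale0r add0r scaler_eq0 negb_or => /andP[b0 _].
  by rewrite hamming_weightZ.
move=> _; have -> : a *: u + b *: v = a *: (u - (- (b / a)) *: v).
  by rewrite scaleNr opprK scalerDr scalerA mulrC divfK.
by rewrite hamming_weightZ.
Qed.

(** The condition on the lines that carry no column follows from the one on the
    lines that do: the vector of an absent line vanishes only at zero columns.
    Conversely a vector of positive weight for each line forces two different
    lines to carry columns. *)
Lemma spread_slopes d (vu : V * V) :
  spread d (slopes vu) =
  free [:: vu.2; vu.1] && avoids_weight d <<[:: vu.2; vu.1]>>.
Proof.
rewrite avoids_weight_span -hamming_weight_vertical.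
rewrite (eq_forallb (fun s => congr1 _ (esym (hamming_weight_slope vu s)))).
set g := slopes vu.
have -> : (d < #|off_colour g None|)%N &&
    [forall s, (d < #|off_colour g (Some s)|)%N] =
    [forall p, (d < #|off_colour g p|)%N].
  apply/andP/forallP => [[h0 /forallP hs] [s|] //|h]; split=> //; exact/forallP.
apply/andP/forallP => [[two /forall_inP h] p|h].
  have [/h //|pg] := boolP (p \in colours g).
  have /card_gt0P[r rg] : (0 < #|colours g|)%N by apply: ltnW.
  apply: leq_trans (h r rg) _; apply/subset_leq_card/subsetP => i.
  rewrite !inE => /andP[-> _] /=; apply: contraNneq pg => gi.
  by apply/coloursP; exists i.
have other p : exists2 r, r \in colours g & r != p.
  have /card_gt0P[i] : (0 < #|off_colour g p|)%N by apply: leq_ltn_trans (h p).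
  rewrite inE; case gi: (g i) => [r|] //= rp; exists r => //.
  by apply/coloursP; exists i.
split; last by apply/forall_inP => p _.
have [r rg _] := other None; have [t tg tr] := other r.
by apply/card_gt1P; exists t, r.
Qed.

Lemma card_off_line (U : {vspace V}) (v : V) : v \in U -> v != 0 ->
  #|[set u | (u \in U) && (u \notin <[v]>%VS)]| = (q ^ \dim U - q)%N.
Proof.
move=> vU v0.
have -> : [set u | (u \in U) && (u \notin <[v]>%VS)] =
    [set u in U] :\: [set u in <[v]>%VS].
  by apply/setP => u; rewrite !inE andbC.
rewrite cardsD (setIidPr _); last first.
  by apply/subsetP => u; rewrite !inE => /vlineP[a ->]; rewrite memvZ.
by rewrite !cardsE !card_vspace dim_vline v0.
Qed.

(** The ordered bases of a plane form one regular orbit of [GL_2(F)], and this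
    is the order of that group. *)
Lemma card_pair_bases (U : {vspace V}) : \dim U = 2%N ->
  #|[set vu : V * V | basis_of U [:: vu.2; vu.1]]| =
  ((q ^ 2 - 1) * (q ^ 2 - q))%N.
Proof.
move=> dimU; rewrite -sum1dep_card.
rewrite (eq_bigl (fun vu : V * V => ((vu.1 \in U) && (vu.1 != 0)) &&
   ((vu.2 \in U) && (vu.2 \notin <[vu.1]>%VS)))); last first.
  move=> [v u] /=; rewrite basisEfree dimU free_cons span_seq1 seq1_free andbT.
  rewrite span_cons span_seq1 subv_add -!memvE.
  by case: (v \in U); case: (u \in U); rewrite ?andbT ?andbF // andbC.
rewrite -(pair_big_dep (fun v : V => (v \in U) && (v != 0))
   (fun v u : V => (u \in U) && (u \notin <[v]>%VS)) (fun _ _ => 1%N)) /=.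
rewrite (eq_bigr (fun=> q ^ 2 - q)%N); last first.
  by move=> v /andP[vU v0]; rewrite sum1dep_card card_off_line // dimU.
rewrite sum_nat_const; congr (_ * _)%N.
have -> : #|[pred v | (v \in U) && (v != 0)]| = #|[set v in U] :\ 0|.
  by apply: eq_card => v; rewrite !inE andbC.
by rewrite cardsDS ?cards1 ?cardsE ?card_vspace ?dimU // sub1set inE mem0v.
Qed.

Definition avoiding_planes d : {set {vspace V}} :=
  [set C : {vspace V} | (\dim C == 2%N) && avoids_weight d C].

(** Both sides count the ordered bases of the avoiding planes, sorted by the
    plane that they span on the left and by their slopes on the right. *)
Lemma card_avoiding_planes d :
  (#|avoiding_planes d| * ((q ^ 2 - 1) * (q ^ 2 - q)) =
   \sum_(g : {ffun 'I_n -> option (option F)} | spread d g)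
      q.-1 ^ #|painted g|)%N.
Proof.
transitivity #|[set vu : V * V | spread d (slopes vu)]|; last first.
  rewrite -sum1dep_card (partition_big slopes (fun g => spread d g)) //=.
  apply: eq_bigr => g sg; rewrite -card_slopes -sum1dep_card.
  by apply: eq_bigl => vu; case: eqP => [->|]; rewrite ?andbT ?andbF.
rewrite -[RHS]sum1dep_card.
rewrite (partition_big (fun vu : V * V => <<[:: vu.2; vu.1]>>%VS)
  [in avoiding_planes d]) /=; last first.
  move=> vu; rewrite spread_slopes inE => /andP[fr ->]; rewrite andbT.
  by move: fr; rewrite /free => /eqP ->.
rewrite -sum_nat_const; apply: eq_bigr => U; rewrite inE => /andP[/eqP dU aU].
rewrite -(card_pair_bases dU) -sum1dep_card; apply: eq_bigl => vu.
rewrite spread_slopes /basis_of; case: eqP => [->|]; rewrite ?andbF //=.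
by rewrite aU !andbT.
Qed.

Definition planes : {set {vspace V}} := [set C : {vspace V} | \dim C == 2%N].

Lemma avoids_weightPn d (C : {vspace V}) :
  reflect (exists v, [/\ v \in C, v != 0 & (hamming_weight v <= d)%N])
          (~~ avoids_weight d C).
Proof.
rewrite negb_forall_in; apply: (iffP exists_inP) => [[v vC]|[v [vC v0 vd]]].
  by rewrite negb_imply -leqNgt => /andP[v0 vd]; exists v.
by exists v; rewrite // negb_imply -leqNgt v0.
Qed.

Lemma betaE d :
  beta F 2 n d = #|[set C in planes | ~~ avoids_weight d C]|.
Proof.
apply: eq_card => C; rewrite !inE; congr andb.
by apply/exists_inP/avoids_weightPn => [[v vC /andP[]]|[v [vC v0 vd]]];
   exists v => //; apply/andP.
Qed.

Lemma hamming_weight_gt0 (v : V) : (0 < hamming_weight v)%N = (v != 0).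
Proof.
apply/idP/idP => [|/eqP v0]; first by apply: contraTneq => ->; rewrite hamming_weight0.
rewrite lt0n; apply/eqP => /card0_eq h; apply: v0; apply/rowP => i.
by have := h i; rewrite !inE mxE => /negbFE/eqP.
Qed.

Lemma avoiding_planes0 : avoiding_planes 0 = planes.
Proof.
apply/setP => C; rewrite !inE; case: (\dim C == 2%N) => //=.
by apply/negPn/avoids_weightPn => -[v [_]]; rewrite -hamming_weight_gt0 lt0n
  leqn0 => /negP.
Qed.

Lemma beta_avoiding d :
  (beta F 2 n d + #|avoiding_planes d| = #|avoiding_planes 0|)%N.
Proof.
rewrite betaE avoiding_planes0 -(cardsID (avoiding_planes d) planes) addnC.
by congr (_ + _)%N; apply: eq_card => C; rewrite !inE;
  case: (\dim C == 2%N); rewrite ?andbT ?andbF.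
Qed.

(** * Light lines and the Möbius function in rank two *)

Lemma size_basis_seq (U : {vspace V}) (X : seq V) :
  basis_of U X -> size X = \dim U.
Proof. by case/andP => /eqP <- /eqP. Qed.

Lemma has_light_basisP d (U : {vspace V}) :
  reflect (exists2 X : seq V, basis_of U X &
             all (fun v => (hamming_weight v <= d)%N) X)
          (has_light_basis d U).
Proof.
apply: (iffP existsP) => [[X /andP[]]|[X bX lX]]; first by exists X.
have szX : size X == \dim U by rewrite (size_basis_seq bX).
by exists (Tuple szX); rewrite bX.
Qed.

Definition light_vectors d : {set V} :=
  [set v : V | (v != 0) && (hamming_weight v <= d)%N].

Definition light_lines d (C : {vspace V}) : {set {vspace V}} :=
  [set L : {vspace V} | (\dim L == 1%N) && (L <= C)%VS & has_light_basis d L].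

Lemma light_linesP d (C L : {vspace V}) :
  reflect (exists v, [/\ v \in light_vectors d, v \in C & L = <[v]>%VS])
          (L \in light_lines d C).
Proof.
rewrite inE; apply: (iffP andP) => [[/andP[/eqP dL LC]]|[v []]].
  case/has_light_basisP => -[|v [|w X]] bX; have := size_basis_seq bX; rewrite dL //.
  move=> _; rewrite /= andbT => vd; exists v; rewrite inE vd.
  have sL := span_basis bX; have := basis_free bX.
  rewrite span_seq1 in sL; rewrite seq1_free => ->; split=> //.
  by rewrite memvE sL.
rewrite inE => /andP[v0 vd] vC ->; rewrite dim_vline v0 -memvE vC; split=> //.
apply/has_light_basisP; exists [:: v]; last by rewrite /= vd.
by rewrite /basis_of span_seq1 seq1_free eqxx.
Qed.

Lemma eq_vline (v w : V) : v != 0 -> v \in <[w]>%VS -> <[v]>%VS = <[w]>%VS.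
Proof.
move=> v0 vw; apply/eqP; rewrite eqEdim -memvE vw !dim_vline v0.
exact: leq_b1.
Qed.

Lemma light_lines_gt0 d C : (0 < #|light_lines d C|)%N = ~~ avoids_weight d C.
Proof.
apply/card_gt0P/avoids_weightPn => [[L /light_linesP[v]]|[v [vC v0 vd]]].
  by rewrite inE => -[/andP[v0 vd] vC _]; exists v.
by exists <[v]>%VS; apply/light_linesP; exists v; rewrite inE v0.
Qed.

(** Two distinct lines of a plane span it. *)
Lemma light_lines_gt1 d C :
  \dim C = 2%N -> (1 < #|light_lines d C|)%N = has_light_basis d C.
Proof.
move=> dC; apply/card_gt1P/has_light_basisP.
  move=> [_ [_ [/light_linesP[v [lv vC ->]] /light_linesP[w [lw wC ->]] nvw]]].
  move: lv lw; rewrite !inE => /andP[v0 vd] /andP[w0 wd].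
  exists [:: v; w]; last by rewrite /= vd wd.
  rewrite basisEfree dC free_cons !span_cons span_nil addv0 seq1_free w0.
  rewrite subv_add -!memvE vC wC !andbT.
  by apply: contraNN nvw => vw; rewrite (eq_vline v0 vw).
move=> [[|v [|w [|z X]]] bX]; have := size_basis_seq bX; rewrite dC //= andbT.
move=> _ /andP[vd wd]; exists <[v]>%VS, <[w]>%VS.
have := basis_free bX; rewrite free_cons span_seq1 seq1_free => /andP[vw w0].
have v0 : v != 0 by apply: contraNneq vw => ->; rewrite mem0v.
split; last by apply: contraNneq vw => <-; rewrite memv_line.
  by apply/light_linesP; exists v; rewrite inE v0 vd (basis_mem bX) ?mem_head.
by apply/light_linesP; exists w; rewrite inE w0 wd (basis_mem bX) ?inE ?eqxx ?orbT.
Qed.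


Lemma sum_dowling d (P : pred {vspace V}) (f : {vspace V} -> int) :
  \sum_(U : dowling F n d | P U) f U =
  \sum_(C | has_light_basis d C && P C) f C.
Proof.
rewrite [RHS](reindex_omap (val : dowling F n d -> {vspace V}) insub); last first.
  by move=> C /andP[lC _]; rewrite insubT.
apply: eq_bigl => -[C lC] /=; rewrite lC insubT /=.
by rewrite (_ : Some _ == _) ?andbT //; apply/eqP; congr Some; apply: val_inj.
Qed.

Lemma dowling_lt d (U W : dowling F n d) :
  (U < W)%O = (U <= W)%VS && (\dim U < \dim W)%N.
Proof.
rewrite lt_neqAle.
have -> : (U <= W)%O = (U <= W)%VS by [].
have [UW|] := boolP (U <= W)%VS; rewrite ?andbF // andbT.
by rewrite -(inj_eq val_inj) /= eqEdim UW -ltnNge.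
Qed.

Lemma dowling_dim0 d (U : dowling F n d) : (\dim U == 0%N) = (U == \bot%O).
Proof. by rewrite dimv_eq0. Qed.

Lemma mobius_line d (U : dowling F n d) :
  \dim U = 1%N -> mobius \bot%O U = -1.
Proof.
move=> dU; have bU : (\bot < U)%O by rewrite dowling_lt sub0v dimv0 dU.
rewrite mobius_lt // (big_pred1 \bot%O) ?mobiusxx // => z.
rewrite le0x /= dowling_lt dU ltnS leqn0 dowling_dim0.
by rewrite andbC; have [->|] := eqVneq z; rewrite // sub0v.
Qed.

(** Strictly below a plane of the lattice there are only the zero space, with
    value [1], and the light lines in it, each with value [- 1]. *)
Lemma mobius_plane d (U : dowling F n d) :
  \dim U = 2%N -> mobius \bot%O U = #|light_lines d U|%:Z - 1.
Proof.
move=> dU; have bU : (\bot < U)%O by rewrite dowling_lt sub0v dimv0 dU.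
rewrite mobius_lt // (bigD1 \bot%O) ?lexx ?bU //= mobiusxx opprD addrC.
congr (_ - _).
rewrite (eq_big (fun z : dowling F n d => (\dim z == 1%N) && (z <= U)%VS)
           (fun=> -1)).
- rewrite sumrN opprK (sum_dowling _
    (fun L => (\dim L == 1%N) && (L <= U)%VS) (fun=> 1)).
  rewrite (eq_bigl (fun L => L \in light_lines d U)).
    by rewrite sumr_const natz.
  by move=> L; rewrite inE andbC.
- move=> z; rewrite le0x /= dowling_lt dU -dowling_dim0.
  by case: (\dim z) => [|[|k]]; rewrite /= ?ltnS ?ltn0 ?andbF ?andbT.
- move=> z /andP[/andP[_ zU] zb]; apply: mobius_line.
  move: zU zb; rewrite dowling_lt dU -dowling_dim0 => /andP[_].
  by case: (\dim z) => [|[|k]].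
Qed.

(** A plane with [a] light lines belongs to the lattice iff [a >= 2] and is
    counted by [beta] iff [a >= 1]; in each of the cases [a = 0], [a = 1] and
    [a >= 2], its contributions to the left-hand side add up to [a]. *)
Lemma whitney_light_lines d :
  whitney F 2 n d + (beta F 2 n d)%:Z =
  (\sum_(C in planes) #|light_lines d C|)%N%:Z.
Proof.
rewrite /whitney (eq_bigr _ (fun U dU => mobius_plane (eqP dU))).
rewrite (sum_dowling _ (fun C => \dim C == 2%N)
  (fun C => #|light_lines d C|%:Z - 1)).
have -> : \sum_(C | has_light_basis d C && (\dim C == 2%N))
      (#|light_lines d C|%:Z - 1) =
    \sum_(C in planes) if has_light_basis d C then #|light_lines d C|%:Z - 1 else 0.
  by rewrite -big_mkcondr; apply: eq_bigl => C; rewrite inE andbC.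
have -> : (beta F 2 n d)%:Z =
    \sum_(C in planes) if ~~ avoids_weight d C then 1 else 0.
  rewrite -big_mkcondr betaE -sum1_card -natz natr_sum.
  by apply: eq_bigl => C; rewrite inE.
rewrite -natz natr_sum -big_split.
apply: eq_bigr => C; rewrite inE => /eqP dC /=.
rewrite -light_lines_gt0 -light_lines_gt1 // natz.
by case: #|_| => [|[|k]] //=; rewrite ?subrr // subrK.
Qed.

(** A vector outside the line of [v] spans a plane together with [v], and a
    plane through [v] contains [q ^ 2 - q] such vectors. *)
Lemma card_planes_through (v : V) : v != 0 ->
  (#|[set C in planes | v \in C]| * (q ^ 2 - q) = q ^ n - q)%N.
Proof.
move=> v0; have := card_off_line (memvf v) v0.
rewrite dimvf /dim /= mul1n => <-.
rewrite -[RHS]sum1dep_card.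
rewrite (partition_big (fun u => <<[:: u; v]>>%VS)
  [in [set C in planes | v \in C]]) /=; last first.
  move=> u /andP[_ uv]; have fr : free [:: u; v].
    by rewrite free_cons span_seq1 uv seq1_free.
  by rewrite !inE memv_span ?inE ?eqxx ?orbT // andbT; move: fr; rewrite /free.
rewrite -sum_nat_const; apply: eq_bigr => C; rewrite !inE => /andP[/eqP dC vC].
rewrite -dC -(card_off_line vC v0) -sum1dep_card; apply: eq_bigl => u.
rewrite memvf /=.
apply/andP/andP => [[uC uv]|[uv /eqP <-]].
  split=> //.
  have : basis_of C [:: u; v].
    rewrite basisEfree dC free_cons span_seq1 uv seq1_free v0.
    by rewrite span_cons span_seq1 subv_add -!memvE uC vC.
  by case/andP.
by split=> //; rewrite memv_span ?mem_head.
Qed.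

(** Each light line consists of [q - 1] light vectors and zero, so the left-hand
    side counts incidences between light vectors and planes. *)
Lemma sum_light_lines d :
  ((\sum_(C in planes) #|light_lines d C|) * q.-1 * (q ^ 2 - q) =
   #|light_vectors d| * (q ^ n - q))%N.
Proof.
have lines C : (#|light_lines d C| * q.-1 =
    \sum_(v in light_vectors d | v \in C) 1)%N.
  rewrite (partition_big (fun v => <[v]>%VS) [in light_lines d C]) /=; last first.
    by move=> v /andP[lv vC]; apply/light_linesP; exists v.
  rewrite -sum_nat_const; apply: eq_bigr => _ /light_linesP[v [lv vC ->]].
  move: lv; rewrite inE => /andP[v0 vd].
  rewrite -(cardC1 (0 : F)) -(card_imset _ (f := fun a => a *: v)); last first.
    by move=> a b /eqP; rewrite -subr_eq0 -scalerBl scaler_eq0 (negPf v0) orbF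
      subr_eq0 => /eqP.
  rewrite -sum1_card; apply: eq_bigl => w; rewrite inE.
  apply/imsetP/andP => [[a]|[/andP[/andP[w0 _] _] /eqP wv]].
    rewrite inE => a0 ->; rewrite scaler_eq0 negb_or a0 v0 hamming_weightZ // vd.
    by rewrite memvZ //; split=> //; apply/eqP/eq_vline;
      rewrite ?scaler_eq0 ?negb_or ?a0 ?memvZ ?memv_line.
  have : w \in <[v]>%VS by rewrite -wv memv_line.
  case/vlineP => a wa; exists a => //; rewrite inE.
  by apply: contraNneq w0 => a0; rewrite wa a0 scale0r.
rewrite big_distrl /= (eq_bigr _ (fun C _ => lines C)).
rewrite (exchange_big_dep [in light_vectors d]) /=; last by move=> C v _ /andP[].
rewrite big_distrl /= -sum_nat_const; apply: eq_bigr => v lv.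
rewrite sum1dep_card -(card_planes_through (v := v)); last first.
  by move: lv; rewrite inE => /andP[].
by congr (_ * _)%N; apply: eq_card => C; move: lv; rewrite !inE => ->.
Qed.

(** A vector is given by its support and a nonzero entry at each position of
    the support. *)
Lemma card_light_vectors d :
  #|light_vectors d| =
  (\sum_(S : {set 'I_n} | 0 < #|S| <= d) q.-1 ^ #|S|)%N.
Proof.
pose support (v : V) : {set 'I_n} := [set i | v 0 i != 0].
have supportT v : #|support v| = hamming_weight v by [].
rewrite -[LHS]sum1_card.
rewrite (partition_big support (fun S => 0 < #|S| <= d)%N) /=; last first.
  by move=> v; rewrite inE supportT hamming_weight_gt0.
apply: eq_bigr => S Sd.
pose entries (v : V) : {ffun 'I_n -> F} := [ffun i => v 0 i].
have entriesB : bijective entries.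
  exists (fun f : {ffun _} => \row_i f i) => [v|f].
    by apply/rowP => i; rewrite mxE ffunE.
  by apply/ffunP => i; rewrite ffunE mxE.
transitivity #|entries @^-1: family (fun i => [pred x | (x != 0) == (i \in S)])|.
  rewrite sum1dep_card; apply: eq_card => v; rewrite !inE.
  transitivity (support v == S).
    have [vS|] := eqVneq (support v) S; rewrite ?andbF // andbT -hamming_weight_gt0.
    by rewrite -supportT vS.
  apply/eqP/familyP => [<- i|h]; first by rewrite !inE ffunE.
  by apply/setP => i; have := h i; rewrite !inE ffunE => /eqP.
rewrite on_card_preimset; last exact: onW_bij.
rewrite card_family foldrE big_map big_enum /= -prod_nat_const.
rewrite [RHS]big_mkcond /=; apply: eq_bigr => i _; case: ifP => _.
  by rewrite -(cardC1 (0 : F)); apply: eq_card => x; rewrite !inE unfold_in;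
    case: (x == 0).
by rewrite -(card1 (0 : F)); apply: eq_card => x; rewrite !inE unfold_in;
    case: (x == 0).
Qed.

End Planes.

(** * Polynomiality *)

(** The quotient by the order of [GL_2] of the number of matrices attached to a
    colouring with [k] colours and [m] painted positions. *)
Definition pattern_quotient (k m : nat) : {poly rat} :=
  ('X - 1) ^+ (m - 2) * (\prod_(i < k - 2) ('X - 1 - i%:R%:P)) * (k`!%:R^-1)%:P.

(** The order of [GL_2] is [(q + 1) * q * (q - 1) ^ 2]: the factor
    [(q + 1) * q] is taken from the binomial coefficient, whose numerator is the
    falling factorial of [q + 1], and [(q - 1) ^ 2] from the power. *)
Lemma pattern_quotientE (q k m : nat) : (0 < q)%N -> (1 < k)%N -> (1 < m)%N ->
  'C(q.+1, k)%:R * (q.-1 ^ m)%:R =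
  (pattern_quotient k m).[q%:R] * ((q ^ 2 - 1) * (q ^ 2 - q))%:R.
Proof.
case: q k m => [|r] [|[|k]] [|[|m]] // _ _ _.
have fact_neq0 : k.+2`!%:R != 0 :> rat by rewrite pnatr_eq0 -lt0n fact_gt0.
have -> : ((r.+1 ^ 2 - 1) * (r.+1 ^ 2 - r.+1) = r.+2 * r.+1 * r ^ 2)%N.
  rewrite -[X in ((_ - X) * _)%N](exp1n 2) subn_sqr subn1 addn1.
  by rewrite -[X in (_ * (_ - X))%N]muln1 -mulnn -mulnBr subn1 /= -mulnn; ring.
rewrite /pattern_quotient !subSS !subn0 !hornerE horner_prod.
have r1 : r.+1%:R - 1 = r%:R :> rat by rewrite -natr1 addrK.
under eq_bigr do rewrite !hornerE r1.
rewrite -natr_ffact r1 -natrX; apply: (mulIf fact_neq0).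
rewrite mulrAC -natrM bin_ffact !ffactnS /=.
transitivity ((r ^ m)%:R * (r ^_ k)%:R * (r.+2 * r.+1 * r ^ 2)%:R : rat).
  by rewrite -!natrM !expnS; congr (_%:R); ring.
by rewrite [RHS]mulrAC divfK // -mulnn !mulnA.
Qed.

Lemma poly_avoiding_planes n d :
  poly_in_card (fun F => #|avoiding_planes F n d|%:R).
Proof.
apply: (@eq_poly_in_card _ (fun F => \sum_(k < n.+1)
  \sum_(h : {ffun 'I_n -> option 'I_k} | (colours h == setT) && spread d h)
    (pattern_quotient k #|painted h|).[#|F|%:R])); last first.
  by do 2!apply: poly_in_card_sum => ? _; apply: poly_in_card_horner.
move=> F; have q_gt1 := finNzRing_gt1 F.
have := card_avoiding_planes F n d; set q := #|F| in q_gt1 *.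
rewrite [in RHS]big_mkcond (sum_by_colours
  (W := fun P g => if spread d g then (q.-1 ^ #|painted g|)%N else 0%N)); last first.
  by move=> Q Q' phi g phiI; rewrite painted_recolour spread_recolour.
rewrite card_option -/q => eqT.
have GL2_neq0 : ((q ^ 2 - 1) * (q ^ 2 - q))%N%:R != 0 :> rat.
  rewrite pnatr_eq0 -lt0n muln_gt0 !subn_gt0.
  have := ltn_exp2l 1 2 q_gt1; have := ltn_exp2l 0 2 q_gt1; rewrite expn0 expn1.
  by move=> -> ->.
apply: (mulIf GL2_neq0); rewrite -natrM eqT natr_sum big_distrl.
apply: eq_bigr => k _; rewrite -big_mkcondr natrM natr_sum big_distrl big_distrr /=.
apply: eq_bigr => h /andP[/eqP hT sh].
have k_gt1 : (1 < k)%N by move: sh; rewrite /spread hT cardsT card_ord => /andP[].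
have m_gt1 : (1 < #|painted h|)%N.
  by rewrite (leq_trans k_gt1) // -[k in (k <= _)%N]card_ord -cardsT -hT
    card_colours_le.
exact: pattern_quotientE (ltnW q_gt1) k_gt1 m_gt1.
Qed.

Lemma poly_beta n d : poly_in_card (fun F => (beta F 2 n d)%:R).
Proof.
apply: (@eq_poly_in_card _ (fun F =>
  #|avoiding_planes F n 0|%:R - #|avoiding_planes F n d|%:R)).
  by move=> F; rewrite -(beta_avoiding F n d) natrD addrK.
by apply: poly_in_cardB; apply: poly_avoiding_planes.
Qed.

(** With [x = q - 1], the equation [sum_light_lines] reads
    [T * x * (q * x) = (\sum_S x ^ #|S|) * (q * x * (1 + q + ... + q ^ (n - 2)))]
    for the sum [T], and the sets [S] are nonempty, so [x * (q * x)] cancels. *)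
Lemma poly_sum_light_lines n d : (0 < n)%N ->
  poly_in_card (fun F => (\sum_(C in planes F n) #|light_lines d C|)%N%:R).
Proof.
case: n => // n _.
apply: (@eq_poly_in_card _ (fun F =>
  (\sum_(S : {set 'I_n.+1} | (0 < #|S| <= d)%N) (('X - 1) ^+ #|S|.-1).[#|F|%:R]) *
  (\sum_(i < n) 'X^i).[#|F|%:R])); last first.
  apply: poly_in_cardM; last exact: poly_in_card_horner.
  by apply: poly_in_card_sum => S _; apply: poly_in_card_horner.
move=> F; have q_gt1 := finNzRing_gt1 F.
have := sum_light_lines F n.+1 d; rewrite card_light_vectors.
set T := (\sum_(C in _) _)%N; set q := #|F| in q_gt1 * => eqT.
case: q q_gt1 eqT => // r r_gt0 /= /(congr1 (fun m => m%:R : rat)).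
have x1 : r.+1%:R - 1 = r%:R :> rat by rewrite -natr1 addrK.
have geom : (r.+1 ^ n.+1 - r.+1)%N%:R =
    r.+1%:R * r%:R * (\sum_(i < n) 'X^i).[r.+1%:R] :> rat.
  rewrite natrB ?natrX; last by rewrite -[X in (X <= _)%N]expn1 leq_pexp2l.
  rewrite exprS -[X in _ - X]mulr1 -mulrBr subrX1 x1 mulrA horner_sum.
  by congr (_ * _); apply: eq_bigr => i _; rewrite hornerXn.
have -> : (r.+1 ^ 2 - r.+1 = r.+1 * r)%N.
  by rewrite -[X in (_ - X)%N]muln1 -mulnn -mulnBr subn1.
rewrite !natrM natr_sum geom.
have -> : \sum_(S : {set 'I_n.+1} | (0 < #|S| <= d)%N) (r ^ #|S|)%:R =
    r%:R * \sum_(S : {set 'I_n.+1} | (0 < #|S| <= d)%N)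
       (('X - 1) ^+ #|S|.-1).[r.+1%:R] :> rat.
  rewrite big_distrr /=; apply: eq_bigr => S /andP[S_gt0 _].
  by rewrite !hornerE x1 natrX -exprS prednK.
move=> eqT; have x0 : r%:R * (r.+1%:R * r%:R) != 0 :> rat.
  by rewrite !mulf_neq0 // pnatr_eq0 -lt0n.
apply: (mulIf x0); rewrite [LHS]mulrA eqT; ring.
Qed.

Theorem corollary11p3 (n d : nat) (d_ge2 : (2 <= d)%N) (d_le_n : (d <= n)%N) :
  exists p1 p2 : {poly rat}, forall F : finFieldType,
    (beta F 2 n d)%:R = p1.[#|F|%:R] /\ (whitney F 2 n d)%:~R = p2.[#|F|%:R].
Proof.
have [p1 p1E] := poly_beta n d.
have [p2 p2E] := poly_sum_light_lines d (ltnW (leq_trans d_ge2 d_le_n)).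
exists p1, (p2 - p1) => F; rewrite p1E; split=> //.
rewrite hornerD hornerN -p2E -p1E; apply/eqP.
by rewrite eq_sym subr_eq !pmulrn -intrD whitney_light_lines.
Qed.
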